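(* (Prenex normal form) Let $p:\mathsf{E}\to\mathsf{B}$ be a Gödel fibration. For every object $I$ of $\mathsf{B}$ and every element $\alpha$ of the fibre $\mathsf{E}_I$ there exist objects $X,Y$ of $\mathsf{B}$ and an element $\beta\in\mathsf{E}_{I\times X\times Y}$ such that $\alpha(i)\cong\exists x\,\forall y\,\beta(x,y,i)$, i.e. $$\alpha\cong\coprod_{\pi}\prod_{\pi'}\beta$$ in $\mathsf{E}_I$, where $\pi:I\times X\to I$ and $\pi':I\times X\times Y\to I\times X$ are the projections, and $\beta$ is $\prod$-quantifier-free in the sub-fibration $p'$ of $\coprod$-quantifier-free objects of $p$.
   Context: Conventions. All fibrations are cloven and split (reindexing is strictly functorial) and have a base category with finite products. For $p:\mathsf{E}\to\mathsf{B}$ and $I\in\mathsf{B}$, $\mathsf{E}_I$ is the fibre category over $I$ (its arrows are called vertical); for $u:A\to B$ in $\mathsf{B}$, $u^*:\mathsf{E}_B\to\mathsf{E}_A$ is reindexing. Simple (co)products. $p$ has simple coproducts if for every projection $\pi_I:I\times X\to I$ the functor $\pi_I^*$ has a left adjoint $\coprod_{\pi_I}$, and the Beck-Chevalley condition holds: for every $f:I\to J$ the canonical map $\coprod_{\pi_I}(f\times 1_X)^*\to f^*\coprod_{\pi_J}$ is invertible (with $\pi_J:J\times X\to J$). Dually, $p$ has simple products if each $\pi_I^*$ has a right adjoint $\prod_{\pi_I}$ satisfying the Beck-Chevalley condition. $\coprod$-quantifier-free. If $p$ has simple coproducts, $\alpha\in\mathsf{E}_I$ is $\coprod$-quantifier-free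 if for every $f:A\to I$, every projection $\pi_A:A\times B\to A$, every $\beta\in\mathsf{E}_{A\times B}$ and every vertical arrow $h:f^*\alpha\to\coprod_{\pi_A}\beta$ of $\mathsf{E}_A$, there exist a unique $g:A\to B$ in $\mathsf{B}$ and a unique vertical arrow $\overline h:f^*\alpha\to\langle 1_A,g\rangle^*\beta$ such that $h=(\langle 1_A,g\rangle^*\eta_\beta)\,\overline h$, where $\eta_\beta:\beta\to\pi_A^*\coprod_{\pi_A}\beta$ is the unit of $\coprod_{\pi_A}\dashv\pi_A^*$. $p$ has enough $\coprod$-quantifier-free objects if for every $I$ and every $\alpha\in\mathsf{E}_I$ there are an object $A$ and a $\coprod$-quantifier-free $\beta\in\mathsf{E}_{I\times A}$ with $\alpha\cong\coprod_{\pi_I}\beta$. $\prod$-quantifier-free. If $p$ has simple products, $\alpha\in\mathsf{E}_I$ is $\prod$-quantifier-free if for every $f:A\to I$, every projection $\pi_A:A\times B\to A$, every $\beta\in\mathsf{E}_{A\times B}$ and every vertical $h:\prod_{\pi_A}\beta\to f^*\alpha$, there exist a unique $g:A\to B$ and a unique vertical $\overline h:\langle 1_A,g\rangle^*\beta\to f^*\alpha$ such that $h=\overline h\,(\langle 1_A,g\rangle^*\varepsilon_\beta)$, where $\varepsilon_\beta:\pi_A^*\prod_{\pi_A}\beta\to\beta$ is the counit of $\pi_A^*\dashv\prod_{\pi_A}$. $p$ has enough $\prod$-quantifier-free objects if for every $I$ and $\alpha\in\mathsf{E}_I$ there are $A$ and a $\prod$-quantifier-free $\beta\in\mathsf{E}_{I\times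 A}$ with $\alpha\cong\prod_{\pi_I}\beta$. Skolem and Gödel fibrations. $p$ is a Skolem fibration if: $\mathsf{B}$ is cartesian closed; $p$ has simple products and simple coproducts; $p$ has enough $\coprod$-quantifier-free objects; and if $\alpha\in\mathsf{E}_I$ is $\coprod$-quantifier-free then so is $\prod_\pi\alpha$ for every projection $\pi$ from $I$. In that case the full sub-fibration $p':\mathsf{E}'\to\mathsf{B}$ of $p$ on the $\coprod$-quantifier-free objects has simple products (those of $p$). A Skolem fibration $p$ is a Gödel fibration if $p'$ has enough $\prod$-quantifier-free objects (where $\prod$-quantifier-freeness is meant in $p'$). *)

(* Defs.v *)
From Stdlib Require Import ProofIrrelevance.

Set Implicit Arguments.
Unset Strict Implicit.
Unset Printing Implicit Defensive.

Declare Scope cat_scope.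
Delimit Scope cat_scope with cat.
Local Open Scope cat_scope.

Record Category := {
  Ob :> Type;
  Hom : Ob -> Ob -> Type;
  idm : forall A : Ob, Hom A A;
  comp : forall A B C : Ob, Hom B C -> Hom A B -> Hom A C;
  comp_id_l : forall (A B : Ob) (f : Hom A B), comp (idm B) f = f;
  comp_id_r : forall (A B : Ob) (f : Hom A B), comp f (idm A) = f;
  comp_assoc : forall (A B C D : Ob)
    (h : Hom C D) (g : Hom B C) (f : Hom A B),
    comp h (comp g f) = comp (comp h g) f
}.
Arguments Hom {_} _ _.
Arguments idm {_} _.
Arguments comp {_ _ _ _} _ _.

Notation "g ∘ f" := (comp g f) (at level 40, left associativity) : cat_scope.

Definition is_iso (C : Category) (a b : C) (f : Hom a b) : Prop :=
  exists g : Hom b a, g ∘ f = idm a /\ f ∘ g = idm b.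

Definition isomorphic (C : Category) (a b : C) : Prop :=
  exists f : Hom a b, is_iso f.

Notation "a ≅ b" := (isomorphic a b) (at level 70) : cat_scope.

Definition cast (C : Category) (a b : C) (e : a = b) : Hom a b :=
  match e in _ = c return Hom a c with eq_refl => idm a end.

Record Functor (C D : Category) := {
  fobj :> C -> D;
  fmap : forall a b : C, Hom a b -> Hom (fobj a) (fobj b);
  fmap_id : forall a : C, fmap (idm a) = idm (fobj a);
  fmap_comp : forall (a b c : C) (g : Hom b c) (f : Hom a b),
    fmap (g ∘ f) = fmap g ∘ fmap f
}.
Arguments fmap {_ _} _ {_ _} _.

Record Adjunction (C D : Category) (L : Functor C D) (R : Functor D C) := {
  adj_unit : forall c : C, Hom c (R (L c));
  adj_counit : forall d : D, Hom (L (R d)) d;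
  adj_unit_nat : forall (c c' : C) (f : Hom c c'),
    adj_unit c' ∘ f = fmap R (fmap L f) ∘ adj_unit c;
  adj_counit_nat : forall (d d' : D) (g : Hom d d'),
    g ∘ adj_counit d = adj_counit d' ∘ fmap L (fmap R g);
  adj_triangle_L : forall c : C,
    adj_counit (L c) ∘ fmap L (adj_unit c) = idm (L c);
  adj_triangle_R : forall d : D,
    fmap R (adj_counit d) ∘ adj_unit (R d) = idm (R d)
}.

Class FiniteProducts (B : Category) := {
  terminal : B;
  to_terminal : forall A : B, Hom A terminal;
  to_terminal_uniq : forall (A : B) (f : Hom A terminal), f = to_terminal A;
  prod_ob : B -> B -> B;
  pr1 : forall A1 A2 : B, Hom (prod_ob A1 A2) A1;
  pr2 : forall A1 A2 : B, Hom (prod_ob A1 A2) A2;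
  pairing : forall C A1 A2 : B, Hom C A1 -> Hom C A2 -> Hom C (prod_ob A1 A2);
  pr1_pairing : forall (C A1 A2 : B) (f : Hom C A1) (g : Hom C A2),
    pr1 A1 A2 ∘ pairing f g = f;
  pr2_pairing : forall (C A1 A2 : B) (f : Hom C A1) (g : Hom C A2),
    pr2 A1 A2 ∘ pairing f g = g;
  pairing_uniq : forall (C A1 A2 : B) (h : Hom C (prod_ob A1 A2)),
    h = pairing (pr1 A1 A2 ∘ h) (pr2 A1 A2 ∘ h)
}.
Arguments pr1 {_ _} _ _.
Arguments pr2 {_ _} _ _.
Arguments pairing {_ _ _ _ _} _ _.

Notation "A × B" := (prod_ob A B) (at level 40, left associativity) : cat_scope.
Notation "⟨ f , g ⟩" := (pairing f g) : cat_scope.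

Definition prod_map (B : Category) (FP : FiniteProducts B) (A A' C C' : B)
    (f : Hom A A') (g : Hom C C') : Hom (A × C) (A' × C') :=
  ⟨ f ∘ pr1 A C , g ∘ pr2 A C ⟩.

Class CartesianClosed (B : Category) (FP : FiniteProducts B) := {
  exp_ob : B -> B -> B;
  eval : forall A C : B, Hom (exp_ob A C × A) C;
  curry : forall D A C : B, Hom (D × A) C -> Hom D (exp_ob A C);
  eval_curry : forall (D A C : B) (f : Hom (D × A) C),
    eval A C ∘ prod_map FP (curry f) (idm A) = f;
  curry_uniq : forall (D A C : B) (k : Hom D (exp_ob A C)),
    k = curry (eval A C ∘ prod_map FP k (idm A))
}.

Set Primitive Projections.
Record FibOb (E B : Category) (p : Functor E B) (I : B) := MkFibOb {
  fib_ob : E;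
  fib_eq : p fib_ob = I
}.
Unset Primitive Projections.
Arguments MkFibOb {_ _} _ {_} _ _.

(** [over a b u f] says that [p f = u], up to the equalities [p a = I] and
    [p b = J] carried by the objects [a] and [b]. *)
Definition over (E B : Category) (p : Functor E B) (I J : B)
    (a : FibOb p I) (b : FibOb p J) (u : Hom I J)
    (f : Hom (fib_ob a) (fib_ob b)) : Prop :=
  cast (fib_eq b) ∘ fmap p f = u ∘ cast (fib_eq a).
Arguments over {_ _ _ _ _} _ _ _ _.

Definition OverHom (E B : Category) (p : Functor E B) (I J : B)
    (u : Hom I J) (a : FibOb p I) (b : FibOb p J) : Type :=
  { f : Hom (fib_ob a) (fib_ob b) | over a b u f }.

Definition arr (E B : Category) (p : Functor E B) (I J : B)
    (u : Hom I J) (a : FibOb p I) (b : FibOb p J) (f : OverHom u a b) :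
    Hom (fib_ob a) (fib_ob b) := proj1_sig f.

Lemma arr_inj (E B : Category) (p : Functor E B) (I J : B)
    (u : Hom I J) (a : FibOb p I) (b : FibOb p J) (f g : OverHom u a b) :
  arr f = arr g -> f = g.
Proof.
destruct f as [f hf], g as [g hg]; simpl; intros ->.
f_equal; apply proof_irrelevance.
Qed.

Lemma over_id (E B : Category) (p : Functor E B) (I : B) (a : FibOb p I) :
  over a a (idm I) (idm (fib_ob a)).
Proof. now unfold over; rewrite fmap_id, comp_id_l, comp_id_r. Qed.

Lemma over_comp (E B : Category) (p : Functor E B) (I J K : B)
    (a : FibOb p I) (b : FibOb p J) (c : FibOb p K)
    (u : Hom J K) (v : Hom I J) (w : Hom I K)
    (f : Hom (fib_ob b) (fib_ob c)) (g : Hom (fib_ob a) (fib_ob b)) :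
  u ∘ v = w -> over b c u f -> over a b v g -> over a c w (f ∘ g).
Proof.
unfold over; intros <- hf hg.
now rewrite fmap_comp, comp_assoc, hf, <- comp_assoc, hg, comp_assoc.
Qed.

Definition ocomp (E B : Category) (p : Functor E B) (I J K : B)
    (a : FibOb p I) (b : FibOb p J) (c : FibOb p K)
    (u : Hom J K) (v : Hom I J) (w : Hom I K) (e : u ∘ v = w)
    (f : OverHom u b c) (g : OverHom v a b) : OverHom w a c :=
  exist _ (arr f ∘ arr g) (over_comp e (proj2_sig f) (proj2_sig g)).

Definition Fibre (E B : Category) (p : Functor E B) (I : B) : Category.
Proof.
refine {|
  Ob := FibOb p I;
  Hom := fun a b => OverHom (idm I) a b;
  idm := fun a => exist _ (idm (fib_ob a)) (over_id a);
  comp := fun a b c g f => ocomp (comp_id_l (idm I)) g f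
|}.
- intros a b f; apply arr_inj; apply comp_id_l.
- intros a b f; apply arr_inj; apply comp_id_r.
- intros a b c d h g f; apply arr_inj; apply comp_assoc.
Defined.

Lemma arr_id (E B : Category) (p : Functor E B) (I : B) (a : Fibre p I) :
  arr (idm a : OverHom (idm I) a a) = idm (fib_ob a).
Proof. reflexivity. Qed.

Lemma arr_comp (E B : Category) (p : Functor E B) (I : B) (a b c : Fibre p I)
    (g : Hom b c) (f : Hom a b) :
  arr (g ∘ f : OverHom (idm I) a c) =
    arr (g : OverHom (idm I) b c) ∘ arr (f : OverHom (idm I) a b).
Proof. reflexivity. Qed.

(** A choice of cartesian lifts. Factorisations through a cartesian arrow are
    given by the operation [factor]; being unique, they involve no choice. *)
Record Cleavage (E B : Category) (p : Functor E B) := {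
  rx : forall (I J : B) (u : Hom I J), FibOb p J -> FibOb p I;
  lift : forall (I J : B) (u : Hom I J) (b : FibOb p J), OverHom u (rx u b) b;
  factor : forall (I J K : B) (u : Hom I J) (v : Hom K I)
    (b : FibOb p J) (c : FibOb p K),
    OverHom (u ∘ v) c b -> OverHom v c (rx u b);
  factor_comm : forall (I J K : B) (u : Hom I J) (v : Hom K I)
    (b : FibOb p J) (c : FibOb p K) (h : OverHom (u ∘ v) c b),
    arr (lift u b) ∘ arr (factor h) = arr h;
  factor_uniq : forall (I J K : B) (u : Hom I J) (v : Hom K I)
    (b : FibOb p J) (c : FibOb p K) (h : OverHom (u ∘ v) c b)
    (k : OverHom v c (rx u b)),
    arr (lift u b) ∘ arr k = arr h -> k = factor h
}.
Arguments rx {_ _ _} _ {_ _} _ _.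
Arguments lift {_ _ _} _ {_ _} _ _.
Arguments factor {_ _ _} _ {_ _ _ _ _ _ _} _.

Record is_split (E B : Category) (p : Functor E B) (c : Cleavage p) : Prop := {
  split_id : forall (I : B) (b : FibOb p I),
    exists e : rx c (idm I) b = b,
      arr (lift c (idm I) b) = cast (f_equal (@fib_ob _ _ p I) e);
  split_comp : forall (I J K : B) (u : Hom J K) (v : Hom I J) (b : FibOb p K),
    exists e : rx c (u ∘ v) b = rx c v (rx c u b),
      arr (lift c (u ∘ v) b) =
        arr (lift c u b) ∘ arr (lift c v (rx c u b)) ∘
        cast (f_equal (@fib_ob _ _ p I) e)
}.

Record SplitFibration := {
  base : Category;
  base_fp :: FiniteProducts base;
  total : Category;
  functor : Functor total base;
  cleavage : Cleavage functor;
  cleavage_split : is_split cleavage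
}.

Notation "p .[ I ]" := (Fibre (functor p) I)
  (at level 2, left associativity, format "p .[ I ]") : cat_scope.

Section Reindexing.
Context (p : SplitFibration).
Implicit Types I J K : base p.

Lemma lift_inj I J K (u : Hom I J) (v : Hom K I)
    (b : p.[J]) (c : p.[K]) (k k' : OverHom v c (rx (cleavage p) u b)) :
  arr (lift (cleavage p) u b) ∘ arr k = arr (lift (cleavage p) u b) ∘ arr k' ->
  k = k'.
Proof.
intros e.
rewrite (factor_uniq (h := ocomp eq_refl (lift (cleavage p) u b) k')
  (k := k) e).
symmetry; now apply factor_uniq.
Qed.

Definition reindex_map I J (u : Hom I J) (a b : p.[J]) (k : Hom a b) :
    OverHom (idm I) (rx (cleavage p) u a) (rx (cleavage p) u b) :=
  factor (cleavage p)
    (ocomp (w := u ∘ idm I) (eq_trans (comp_id_l u) (eq_sym (comp_id_r u)))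
      k (lift (cleavage p) u a)).

Lemma reindex_map_comm I J (u : Hom I J) (a b : p.[J]) (k : Hom a b) :
  arr (lift (cleavage p) u b) ∘ arr (reindex_map u k) =
  arr k ∘ arr (lift (cleavage p) u a).
Proof. now unfold reindex_map; rewrite factor_comm. Qed.

Definition reindex I J (u : Hom I J) : Functor (p.[J]) (p.[I]).
Proof.
refine {|
  fobj := (rx (cleavage p) u : p.[J] -> p.[I]);
  fmap := fun a b k => reindex_map u k
|}.
- intros a; apply lift_inj.
  rewrite (reindex_map_comm u (idm a)).
  exact (eq_trans (comp_id_l _) (eq_sym (comp_id_r _))).
- intros a b c g f; apply lift_inj.
  rewrite (reindex_map_comm u (g ∘ f)).
  rewrite (arr_comp g f), (arr_comp (reindex_map u g) (reindex_map u f)).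
  rewrite <- comp_assoc, <- (reindex_map_comm u f), comp_assoc.
  now rewrite <- (reindex_map_comm u g), comp_assoc.
Defined.

(** The canonical comparison arrows between iterated reindexings, induced by the
    universal property of the lifts. As the cleavage is split they are the
    identities of strictly equal objects (see [exch_split], [collapse_split]
    and [expand_split]). *)
Definition exch I J J' K (u : Hom J K) (v : Hom I J) (u' : Hom J' K)
    (v' : Hom I J') (e : u ∘ v = u' ∘ v') (c : p.[K]) :
    Hom (reindex v (reindex u c)) (reindex v' (reindex u' c)) :=
  factor (cleavage p) (factor (cleavage p)
    (ocomp (w := u' ∘ (v' ∘ idm I))
      (eq_trans e (f_equal (comp u') (eq_sym (comp_id_r v'))))
      (lift (cleavage p) u c) (lift (cleavage p) v (reindex u c)))).

Definition collapse I J (u : Hom J I) (v : Hom I J) (e : u ∘ v = idm I)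
    (b : p.[I]) : Hom (reindex v (reindex u b)) b :=
  ocomp e (lift (cleavage p) u b) (lift (cleavage p) v (reindex u b)).

Definition expand I J (u : Hom J I) (v : Hom I J) (e : u ∘ v = idm I)
    (b : p.[I]) : Hom b (reindex v (reindex u b)) :=
  factor (cleavage p) (factor (cleavage p)
    (exist (over b b (u ∘ (v ∘ idm I))) (idm (fib_ob b))
      (eq_ind_r (fun w => over b b w (idm (fib_ob b))) (over_id b)
        (eq_trans (f_equal (comp u) (comp_id_r v)) e)))).

Lemma arr_cast I (a b : p.[I]) (e : a = b) :
  arr (cast e : OverHom (idm I) a b) = cast (f_equal (@fib_ob _ _ _ I) e).
Proof. now destruct e. Qed.

Lemma cast_comp_inv I (x y z : p.[I]) (d : total p)
    (e1 : x = y) (e2 : x = z)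
    (f : Hom (fib_ob y) d) (g : Hom (fib_ob z) d) :
  f ∘ cast (f_equal (@fib_ob _ _ _ I) e1) =
    g ∘ cast (f_equal (@fib_ob _ _ _ I) e2) ->
  f = g ∘ cast (f_equal (@fib_ob _ _ _ I) (eq_trans (eq_sym e1) e2)).
Proof. destruct e1, e2; simpl; now rewrite !comp_id_r. Qed.

Lemma lift2_inj I J K L (u : Hom J K) (v : Hom I J) (w : Hom L I)
    (b : p.[K]) (c : p.[L])
    (k k' : OverHom w c (rx (cleavage p) v (rx (cleavage p) u b))) :
  arr (lift (cleavage p) u b) ∘
      (arr (lift (cleavage p) v (rx (cleavage p) u b)) ∘ arr k) =
    arr (lift (cleavage p) u b) ∘
      (arr (lift (cleavage p) v (rx (cleavage p) u b)) ∘ arr k') ->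
  k = k'.
Proof.
intros e; apply lift_inj.
exact (f_equal (@arr _ _ _ _ _ _ _ _) (@lift_inj _ _ _ _ _ _ _
  (ocomp eq_refl (lift (cleavage p) v (rx (cleavage p) u b)) k)
  (ocomp eq_refl (lift (cleavage p) v (rx (cleavage p) u b)) k') e)).
Qed.

Lemma exch_comm I J J' K (u : Hom J K) (v : Hom I J) (u' : Hom J' K)
    (v' : Hom I J') (e : u ∘ v = u' ∘ v') (c : p.[K]) :
  arr (lift (cleavage p) u' c) ∘
    (arr (lift (cleavage p) v' (rx (cleavage p) u' c)) ∘ arr (exch e c)) =
  arr (lift (cleavage p) u c) ∘ arr (lift (cleavage p) v (reindex u c)).
Proof. now unfold exch; rewrite !factor_comm. Qed.

Lemma expand_comm I J (u : Hom J I) (v : Hom I J) (e : u ∘ v = idm I)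
    (b : p.[I]) :
  arr (lift (cleavage p) u b) ∘
    (arr (lift (cleavage p) v (rx (cleavage p) u b)) ∘ arr (expand e b)) =
  idm (fib_ob b).
Proof. now unfold expand; rewrite !factor_comm. Qed.

Lemma exch_split I J J' K (u : Hom J K) (v : Hom I J) (u' : Hom J' K)
    (v' : Hom I J') (e : u ∘ v = u' ∘ v') (c : p.[K]) :
  exists d : reindex v (reindex u c) = reindex v' (reindex u' c),
    exch e c = cast d.
Proof.
destruct (split_comp (cleavage_split p) u' v' c) as [e2 h2].
pose proof (split_comp (cleavage_split p) u v c) as H.
rewrite e in H; destruct H as [e1 h1].
rewrite h2 in h1; symmetry in h1.
exists (eq_trans (eq_sym e1) e2).
apply lift2_inj; rewrite exch_comm, arr_cast, comp_assoc.
exact (cast_comp_inv h1).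
Qed.

Lemma collapse_split I J (u : Hom J I) (v : Hom I J) (e : u ∘ v = idm I)
    (b : p.[I]) :
  exists d : reindex v (reindex u b) = b, collapse e b = cast d.
Proof.
destruct (split_id (cleavage_split p) b) as [e2 h2].
pose proof (split_comp (cleavage_split p) u v b) as H.
rewrite e in H; destruct H as [e1 h1].
rewrite h2 in h1; symmetry in h1.
exists (eq_trans (eq_sym e1) e2).
apply arr_inj; rewrite arr_cast, <- (comp_id_l (cast _)).
apply (@cast_comp_inv _ _ _ _ _ e1 e2); rewrite comp_id_l; exact h1.
Qed.

Lemma expand_split I J (u : Hom J I) (v : Hom I J) (e : u ∘ v = idm I)
    (b : p.[I]) :
  exists d : b = reindex v (reindex u b), expand e b = cast d.
Proof.
destruct (collapse_split e b) as [d h].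
exists (eq_sym d).
apply lift2_inj; rewrite expand_comm, comp_assoc.
change (idm (fib_ob b) =
  arr (collapse e b) ∘ arr (cast (eq_sym d) : OverHom (idm I) _ _)).
rewrite h; clear h.
generalize (reindex v (reindex u b)) d; intros x []; symmetry; apply comp_id_l.
Qed.

End Reindexing.
Arguments reindex p {I J} u.

Lemma bc_square (p : SplitFibration) (I J X : base p) (f : Hom I J) :
  pr1 J X ∘ prod_map _ f (idm X) = f ∘ pr1 I X.
Proof. apply pr1_pairing. Qed.

Definition bc_coprod (p : SplitFibration)
    (S : forall I X : base p, Functor p.[I × X] p.[I])
    (adj : forall I X : base p, Adjunction (S I X) (reindex p (pr1 I X)))
    (I J X : base p) (f : Hom I J) (b : p.[J × X]) :
    Hom (S I X (reindex p (prod_map _ f (idm X)) b)) (reindex p f (S J X b)) :=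
  adj_counit (adj I X) (reindex p f (S J X b)) ∘
  fmap (S I X) (exch (bc_square X f) (S J X b) ∘
                fmap (reindex p (prod_map _ f (idm X)))
                  (adj_unit (adj J X) b)).

Record SimpleCoproducts (p : SplitFibration) := {
  scoprod : forall I X : base p, Functor p.[I × X] p.[I];
  scoprod_adj : forall I X : base p,
    Adjunction (scoprod I X) (reindex p (pr1 I X));
  scoprod_bc : forall (I J X : base p) (f : Hom I J) (b : p.[J × X]),
    is_iso (bc_coprod scoprod_adj f b)
}.

Definition bc_prod (p : SplitFibration)
    (P : forall I X : base p, Functor p.[I × X] p.[I])
    (adj : forall I X : base p, Adjunction (reindex p (pr1 I X)) (P I X))
    (I J X : base p) (f : Hom I J) (b : p.[J × X]) :
    Hom (reindex p f (P J X b)) (P I X (reindex p (prod_map _ f (idm X)) b)) :=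
  fmap (P I X) (fmap (reindex p (prod_map _ f (idm X)))
                  (adj_counit (adj J X) b) ∘
                exch (eq_sym (bc_square X f)) (P J X b)) ∘
  adj_unit (adj I X) (reindex p f (P J X b)).

Record SimpleProducts (p : SplitFibration) := {
  sprod : forall I X : base p, Functor p.[I × X] p.[I];
  sprod_adj : forall I X : base p,
    Adjunction (reindex p (pr1 I X)) (sprod I X);
  sprod_bc : forall (I J X : base p) (f : Hom I J) (b : p.[J × X]),
    is_iso (bc_prod sprod_adj f b)
}.

(** The pair [gh = (g, hbar)] lives in a dependent sum, as the codomain (resp.
    domain, for [prod_qf]) of [hbar] depends on [g]. The arrow [collapse] (resp.
    [expand]) is the identification of [⟨1, g⟩^* π^*] with the identity. *)
Definition coprod_qf (p : SplitFibration) (S : SimpleCoproducts p)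
    (I : base p) (a : p.[I]) : Prop :=
  forall (A : base p) (f : Hom A I) (B : base p) (b : p.[A × B])
    (h : Hom (reindex p f a) (scoprod S A B b)),
  exists! gh : { g : Hom A B &
                 Hom (reindex p f a) (reindex p ⟨ idm A , g ⟩ b) },
    h = collapse (pr1_pairing (idm A) (projT1 gh)) (scoprod S A B b) ∘
        fmap (reindex p ⟨ idm A , projT1 gh ⟩)
          (adj_unit (scoprod_adj S A B) b) ∘
        projT2 gh.

Definition enough_coprod_qf (p : SplitFibration) (S : SimpleCoproducts p) :
    Prop :=
  forall (I : base p) (a : p.[I]),
  exists (A : base p) (b : p.[I × A]), coprod_qf S b /\ a ≅ scoprod S I A b.

Definition prod_qf (p : SplitFibration) (P : SimpleProducts p)
    (I : base p) (a : p.[I]) : Prop :=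
  forall (A : base p) (f : Hom A I) (B : base p) (b : p.[A × B])
    (h : Hom (sprod P A B b) (reindex p f a)),
  exists! gh : { g : Hom A B &
                 Hom (reindex p ⟨ idm A , g ⟩ b) (reindex p f a) },
    h = projT2 gh ∘
        fmap (reindex p ⟨ idm A , projT1 gh ⟩)
          (adj_counit (sprod_adj P A B) b) ∘
        expand (pr1_pairing (idm A) (projT1 gh)) (sprod P A B b).

Definition enough_prod_qf (p : SplitFibration) (P : SimpleProducts p) : Prop :=
  forall (I : base p) (a : p.[I]),
  exists (A : base p) (b : p.[I × A]), prod_qf P b /\ a ≅ sprod P I A b.

Definition full_subcategory (C : Category) (Q : C -> Prop) : Category.
Proof.
refine {|
  Ob := { a : C | Q a };
  Hom := fun a b => Hom (proj1_sig a) (proj1_sig b);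
  idm := fun a => idm (proj1_sig a);
  comp := fun a b c g f => g ∘ f
|}.
- intros; apply comp_id_l.
- intros; apply comp_id_r.
- intros; apply comp_assoc.
Defined.

Section FullSubfibration.
Context (p : SplitFibration) (Q : forall I : base p, p.[I] -> Prop)
  (Q_reindex : forall (I J : base p) (u : Hom I J) (a : p.[J]),
    Q _ a -> Q _ (reindex p u a)).

(** An object of the total category belongs to the sub-fibration when it
    satisfies [Q] in the fibre over its own image. *)
Definition sub_total : Category :=
  full_subcategory (fun a : total p => Q (MkFibOb (functor p) a eq_refl)).

Definition sub_functor : Functor sub_total (base p).
Proof.
refine {|
  fobj := fun a : sub_total => functor p (proj1_sig a);
  fmap := fun a b => @fmap _ _ (functor p) (proj1_sig a) (proj1_sig b)
|}.
- intros a; exact (fmap_id (functor p) (proj1_sig a)).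
- intros a b c g f; exact (@fmap_comp _ _ (functor p) _ _ _ g f).
Defined.

Lemma Q_fib_ob (I : base p) (a : p.[I]) :
  Q a <-> Q (MkFibOb (functor p) (fib_ob a) eq_refl).
Proof. destruct a as [a []]; split; trivial. Qed.

Definition sub_incl (I : base p) (a : Fibre sub_functor I) : p.[I] :=
  MkFibOb (functor p) (proj1_sig (fib_ob a)) (fib_eq a).

Lemma sub_incl_Q (I : base p) (a : Fibre sub_functor I) : Q (sub_incl a).
Proof. apply Q_fib_ob; exact (proj2_sig (fib_ob a)). Qed.

Definition sub_mk (I : base p) (a : p.[I]) (q : Q a) : Fibre sub_functor I :=
  MkFibOb sub_functor (exist _ (fib_ob a) (proj1 (Q_fib_ob a) q) : sub_total)
    (fib_eq a).

Lemma sub_eq (I : base p) (a b : Fibre sub_functor I) :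
  sub_incl a = sub_incl b -> a = b.
Proof.
destruct a as [[a qa] ea], b as [[b qb] eb]; unfold sub_incl; simpl.
simpl in *; intros e; injection e; intros e'; subst b.
rewrite (proof_irrelevance _ qb qa), (proof_irrelevance _ eb ea).
reflexivity.
Qed.

Lemma sub_cast (I : base p) (a b : Fibre sub_functor I) (e : a = b)
    (e' : sub_incl a = sub_incl b) :
  (cast (f_equal (@fib_ob _ _ _ I) e) :
    @Hom (total p) (fib_ob (sub_incl a)) (fib_ob (sub_incl b))) =
  cast (f_equal (@fib_ob _ _ _ I) e').
Proof. destruct e; rewrite (proof_irrelevance _ e' eq_refl); reflexivity. Qed.

Definition sub_cleavage : Cleavage sub_functor.
Proof.
refine {|
  rx := fun I J u b =>
    sub_mk (Q_reindex u (sub_incl_Q b));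
  lift := fun I J u b => (lift (cleavage p) u (sub_incl b));
  factor := fun I J K u v b c h =>
    factor (cleavage p) (b := sub_incl b) (c := sub_incl c) h
|}.
- intros I J K u v b c h.
  exact (@factor_comm _ _ _ (cleavage p) I J K u v
    (sub_incl b) (sub_incl c) h).
- intros I J K u v b c h k.
  exact (@factor_uniq _ _ _ (cleavage p) I J K u v
    (sub_incl b) (sub_incl c) h k).
Defined.

Lemma sub_split : is_split sub_cleavage.
Proof.
split.
- intros I b.
  destruct (split_id (cleavage_split p) (sub_incl b)) as [e h].
  exists (sub_eq (a := rx sub_cleavage (idm I) b) (b := b) e).
  etransitivity; [exact h | symmetry; apply sub_cast].
- intros I J K u v b.
  destruct (split_comp (cleavage_split p) u v (sub_incl b)) as [e h].
  exists (sub_eq (a := rx sub_cleavage (u ∘ v) b)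
    (b := rx sub_cleavage v (rx sub_cleavage u b)) e).
  etransitivity; [exact h |].
  apply (f_equal (comp (arr (lift (cleavage p) u (sub_incl b)) ∘
    arr (lift (cleavage p) v (rx (cleavage p) u (sub_incl b)))))).
  symmetry; exact (@sub_cast I (rx sub_cleavage (u ∘ v) b)
    (rx sub_cleavage v (rx sub_cleavage u b)) _ e).
Qed.

Definition full_subfibration : SplitFibration := {|
  base := base p;
  base_fp := base_fp p;
  total := sub_total;
  functor := sub_functor;
  cleavage := sub_cleavage;
  cleavage_split := sub_split
|}.
Local Notation p' := full_subfibration.

(** The types of arrows in the fibres of [p'] are convertible with those in the
    fibres of [p]. *)
Definition sub_hom (I : base p) (a b : p'.[I]) (f : Hom a b) :
  Hom (sub_incl a) (sub_incl b) := f.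

Lemma sub_hom_id (I : base p) (a : p'.[I]) :
  sub_hom (idm a) = idm (sub_incl a).
Proof. apply arr_inj; reflexivity. Qed.

Lemma sub_hom_comp (I : base p) (a b c : p'.[I]) (g : Hom b c) (f : Hom a b) :
  sub_hom (g ∘ f) = sub_hom g ∘ sub_hom f.
Proof. apply arr_inj; reflexivity. Qed.

Lemma sub_hom_reindex (I J : base p) (u : Hom I J) (a b : p'.[J])
    (k : Hom a b) :
  sub_hom (fmap (reindex p' u) k) = fmap (reindex p u) (sub_hom k).
Proof.
apply (@lift_inj p).
etransitivity; [exact (reindex_map_comm (p := p') u k) |].
symmetry; exact (reindex_map_comm (p := p) u (sub_hom k)).
Qed.

Lemma sub_hom_exch (I J J' K : base p) (u : Hom J K) (v : Hom I J)
    (u' : Hom J' K) (v' : Hom I J') (e : u ∘ v = u' ∘ v') (c : p'.[K]) :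
  sub_hom (exch (p := p') e c) = exch (p := p) e (sub_incl c).
Proof.
apply (@lift2_inj p I J' K I u' v' (idm I) (sub_incl c)
  (reindex p v (reindex p u (sub_incl c)))).
etransitivity; [exact (exch_comm (p := p') e c) |].
symmetry; exact (exch_comm (p := p) e (sub_incl c)).
Qed.

Context (P : SimpleProducts p)
  (Q_prod : forall (I X : base p) (a : p.[I × X]), Q a -> Q (sprod P I X a)).

Definition sub_sprod (I X : base p) : Functor p'.[I × X] p'.[I].
Proof.
refine {|
  fobj := fun a : p'.[I × X] =>
    (sub_mk (Q_prod (sub_incl_Q a)) : p'.[I]);
  fmap := fun a b => @fmap _ _ (sprod P I X) (sub_incl a) (sub_incl b)
|}.
- intros a.
  exact (eq_trans (f_equal (fmap (sprod P I X)) (sub_hom_id a))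
    (eq_trans (fmap_id (sprod P I X) (sub_incl a))
      (eq_sym (sub_hom_id (sub_mk (Q_prod (sub_incl_Q a)) : p'.[I]))))).
- intros a b c g f.
  refine (eq_trans (f_equal (fmap (sprod P I X)) (sub_hom_comp g f))
    (eq_trans (fmap_comp (sprod P I X) (sub_hom g) (sub_hom f)) _)).
  apply arr_inj; reflexivity.
Defined.

Definition sub_unit (I X : base p) (c : p'.[I]) :
    Hom c (sub_sprod I X (reindex p' (pr1 I X) c)) :=
  adj_unit (sprod_adj P I X) (sub_incl c).

Definition sub_counit (I X : base p) (d : p'.[I × X]) :
    Hom (reindex p' (pr1 I X) (sub_sprod I X d)) d :=
  adj_counit (sprod_adj P I X) (sub_incl d).

Definition sub_sprod_adj (I X : base p) :
  Adjunction (reindex p' (pr1 I X)) (sub_sprod I X).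
Proof.
refine (@Build_Adjunction p'.[I] p'.[I × X]
  (reindex p' (pr1 I X)) (sub_sprod I X) (sub_unit X) (@sub_counit I X)
  _ _ _ _).
- intros c c' f.
  refine (eq_trans (sub_hom_comp (sub_unit X c') f)
    (eq_trans (adj_unit_nat (sprod_adj P I X) (sub_hom f))
    (eq_trans _ (eq_sym (sub_hom_comp
      (fmap (sub_sprod I X) (fmap (reindex p' (pr1 I X)) f))
      (sub_unit X c)))))).
  exact (f_equal (fun k => fmap (sprod P I X) k ∘ _)
    (eq_sym (sub_hom_reindex (pr1 I X) f))).
- intros d d' g.
  refine (eq_trans (sub_hom_comp g (sub_counit d))
    (eq_trans (adj_counit_nat (sprod_adj P I X) (sub_hom g))
    (eq_trans _ (eq_sym (sub_hom_comp (sub_counit d')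
      (fmap (reindex p' (pr1 I X)) (fmap (sub_sprod I X) g))))))).
  exact (f_equal (comp (adj_counit (sprod_adj P I X) (sub_incl d')))
    (eq_sym (sub_hom_reindex (pr1 I X) (fmap (sub_sprod I X) g)))).
- intros c.
  refine (eq_trans (sub_hom_comp (sub_counit (reindex p' (pr1 I X) c))
      (fmap (reindex p' (pr1 I X)) (sub_unit X c)))
    (eq_trans _ (eq_trans (adj_triangle_L (sprod_adj P I X) (sub_incl c))
    (eq_sym (sub_hom_id (reindex p' (pr1 I X) c)))))).
  exact (f_equal (comp (adj_counit (sprod_adj P I X)
      (reindex p (pr1 I X) (sub_incl c))))
    (sub_hom_reindex (pr1 I X) (sub_unit X c))).
- intros d.
  exact (eq_trans
      (sub_hom_comp (fmap (sub_sprod I X) (sub_counit d))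
        (sub_unit X (sub_sprod I X d)))
    (eq_trans (adj_triangle_R (sprod_adj P I X) (sub_incl d))
    (eq_sym (sub_hom_id (sub_sprod I X d))))).
Defined.

Lemma sub_sprod_bc (I J X : base p) (f : Hom I J) (b : p'.[J × X]) :
  is_iso (bc_prod (p := p') sub_sprod_adj f b).
Proof.
assert (e : sub_hom (bc_prod (p := p') sub_sprod_adj f b) =
  bc_prod (sprod_adj P) f (sub_incl b)).
{ unfold bc_prod.
  set (fX := prod_map (base_fp p') f (idm X)).
  set (k := fmap (reindex p' fX) (adj_counit (sub_sprod_adj J X) b)).
  set (x := exch (p := p') (eq_sym (bc_square (p := p') X f))
    (sub_sprod J X b)).
  refine (eq_trans (sub_hom_comp (fmap (sub_sprod I X) (k ∘ x))
    (sub_unit X (reindex p' f (sub_sprod J X b)))) _).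
  refine (f_equal (fun k => fmap (sprod P I X) k ∘
    adj_unit (sprod_adj P I X) (reindex p f (sprod P J X (sub_incl b)))) _).
  refine (eq_trans (sub_hom_comp k x) _).
  rewrite (proof_irrelevance _ (bc_square (p := p) X f)
    (bc_square (p := p') X f)).
  exact (f_equal2 comp (sub_hom_reindex fX (sub_counit b))
    (sub_hom_exch (eq_sym (bc_square (p := p') X f)) (sub_sprod J X b))). }
destruct (sprod_bc P f (sub_incl b)) as [g [h1 h2]].
rewrite <- e in h1, h2.
pose (g' := g : @Hom p'.[I]
  (sub_sprod I X (reindex p' (prod_map (base_fp p') f (idm X)) b))
  (reindex p' f (sub_sprod J X b))).
exists g'; split.
- exact (eq_trans (sub_hom_comp g' (bc_prod (p := p') sub_sprod_adj f b))
    (eq_trans h1 (eq_sym (sub_hom_id (reindex p' f (sub_sprod J X b)))))).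
- exact (eq_trans (sub_hom_comp (bc_prod (p := p') sub_sprod_adj f b) g')
    (eq_trans h2 (eq_sym (sub_hom_id (sub_sprod I X
      (reindex p' (prod_map (base_fp p') f (idm X)) b)))))).
Qed.

Definition sub_products : SimpleProducts p' :=
  @Build_SimpleProducts p' sub_sprod sub_sprod_adj sub_sprod_bc.

End FullSubfibration.

Lemma coprod_qf_reindex (p : SplitFibration) (S : SimpleCoproducts p)
    (I J : base p) (u : Hom I J) (a : p.[J]) :
  coprod_qf S a -> coprod_qf S (reindex p u a).
Proof.
unfold coprod_qf; simpl; intros qa A f B b.
destruct (split_comp (cleavage_split p) u f a) as [e _].
rewrite <- e; exact (qa A (u ∘ f) B b).
Qed.

Record SkolemFibration := {
  sk_fib :> SplitFibration;
  sk_ccc : CartesianClosed (base_fp sk_fib);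
  sk_coprod : SimpleCoproducts sk_fib;
  sk_prod : SimpleProducts sk_fib;
  sk_enough : enough_coprod_qf sk_coprod;
  sk_closed : forall (I X : base sk_fib) (a : sk_fib.[I × X]),
    coprod_qf sk_coprod a -> coprod_qf sk_coprod (sprod sk_prod I X a)
}.

Definition coprod_qf_subfibration (p : SkolemFibration) : SplitFibration :=
  full_subfibration (coprod_qf_reindex (S := sk_coprod p)).

Definition coprod_qf_products (p : SkolemFibration) :
    SimpleProducts (coprod_qf_subfibration p) :=
  sub_products (coprod_qf_reindex (S := sk_coprod p)) (@sk_closed p).

Definition coprod_qf_incl (p : SkolemFibration) (I : base p)
    (a : (coprod_qf_subfibration p).[I]) : p.[I] := sub_incl a.

Record GodelFibration := {
  godel_skolem :> SkolemFibration;
  godel_enough : enough_prod_qf (coprod_qf_products godel_skolem)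
}.

(* Main.v *)
Require Import Defs.

(** Enough [∐]-quantifier-free objects give [a ≅ ∐ b0] with [b0]
    [∐]-quantifier-free, so that [b0] is an object of the sub-fibration [p'].
    Enough [∏]-quantifier-free objects in [p'] then give [b0 ≅ ∏ b] in [p'],
    with [b] [∏]-quantifier-free there. The products of [p'] being those of [p],
    the inclusion of [p'] carries this to an isomorphism [b0 ≅ ∏ b] of [p]
    ([isomorphic_sub_incl]), to which the functor [∐] applies
    ([isomorphic_fmap]): [a ≅ ∐ b0 ≅ ∐ ∏ b]. *)

Local Open Scope cat_scope.

Lemma isomorphic_trans (C : Category) (a b c : C) :
  a ≅ b -> b ≅ c -> a ≅ c.
Proof.
intros [f [f' [f'f ff']]] [g [g' [g'g gg']]].
exists (g ∘ f), (f' ∘ g'); split.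
- now rewrite comp_assoc, <- (comp_assoc f' g' g), g'g, comp_id_r.
- now rewrite comp_assoc, <- (comp_assoc g f f'), ff', comp_id_r.
Qed.

Lemma isomorphic_fmap (C D : Category) (F : Functor C D) (a b : C) :
  a ≅ b -> F a ≅ F b.
Proof.
intros [f [g [gf fg]]].
exists (fmap F f), (fmap F g); split.
- now rewrite <- fmap_comp, gf, fmap_id.
- now rewrite <- fmap_comp, fg, fmap_id.
Qed.

(** The fibres of a full sub-fibration have the arrows of the ambient fibres, so
    an inverse pair is the same thing in both; only the proofs that identities
    and composites lie over the identity of [I] have to be reconciled. *)
Lemma isomorphic_sub_incl (p : SplitFibration)
    (Q : forall I : base p, p.[I] -> Prop)
    (Q_reindex : forall (I J : base p) (u : Hom I J) (a : p.[J]),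
      Q _ a -> Q _ (reindex p u a))
    (I : base p) (a b : (full_subfibration Q_reindex).[I]) :
  a ≅ b -> @isomorphic p.[I] (sub_incl a) (sub_incl b).
Proof.
intros [f [g [gf fg]]].
exists (sub_hom f), (sub_hom g); split.
- now rewrite <- sub_hom_comp, gf, sub_hom_id.
- now rewrite <- sub_hom_comp, fg, sub_hom_id.
Qed.

Theorem proposition3p10 (p : GodelFibration) (I : base p) (a : p.[I]) :
  exists (X Y : base p) (b : (coprod_qf_subfibration p).[I × X × Y]),
    prod_qf (coprod_qf_products p) b /\
    a ≅ scoprod (sk_coprod p) I X
          (sprod (sk_prod p) (I × X) Y (coprod_qf_incl b)).
Proof.
destruct (sk_enough a) as [X [b0 [qf_b0 a_iso]]].
destruct (godel_enough
  (sub_mk qf_b0 : (coprod_qf_subfibration p).[I × X]))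
  as [Y [b [qf_b b0_iso]]].
exists X, Y, b; split; [exact qf_b |].
apply (isomorphic_trans _ _ _ _ a_iso).
apply (isomorphic_fmap _ _ (scoprod (sk_coprod p) I X)).
(* Both ends agree with those of [b0_iso] by computation: the inclusion undoes
   [sub_mk], and sends the product of [b] in the sub-fibration to its product
   in the ambient fibration. *)
exact (isomorphic_sub_incl _ _ _ _ _ _ b0_iso).
Qed.
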